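(* Let $\rho_{AB}$ be an arbitrary two-qubit state, written as $$\rho_{AB}=\tfrac14\Big[\mathbb{1}_2\otimes\mathbb{1}_2+\vec m\cdot\vec\sigma\otimes\mathbb{1}_2+\mathbb{1}_2\otimes\vec n\cdot\vec\sigma+\sum_{i,j=1}^3t_{ij}\,\sigma_i\otimes\sigma_j\Big],$$ with $\vec m,\vec n\in\mathbb{R}^3$, $t_{ij}\in\mathbb{R}$. Then $$I_2(\rho_{AB})=\tfrac12\big(|n_1-t_{11}|+|n_1+t_{11}|+|n_2-t_{22}|+|n_2+t_{22}|\big),$$ so that the imaginarity of Bob's local state can be steered by Alice (i.e. the imaginarity steering inequality $I_2(\rho_{AB})\le\sqrt2$ is violated) when $$\tfrac12\big(|n_1-t_{11}|+|n_1+t_{11}|+|n_2-t_{22}|+|n_2+t_{22}|\big)>\sqrt2,$$ a condition involving only the four real parameters $n_1,n_2,t_{11},t_{22}$.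
   Context: $\sigma_1=\sigma_x,\sigma_2=\sigma_y,\sigma_3=\sigma_z$ are the Pauli matrices. For a density matrix $\rho$ on $\mathbb{C}^2$ and an orthonormal basis $\{|e_0\rangle,|e_1\rangle\}$, let $\rho_e=(\langle e_i|\rho|e_j\rangle)_{i,j}$. The robustness of imaginarity of $\rho$ in that basis is $\frac12\|\rho_e-\rho_e^T\|_1$, where $T$ is the transpose and $\|V\|_1=\operatorname{Tr}\sqrt{V^\dagger V}$. $\mathscr{I}_R^x$ denotes this quantity in the $x$-basis $\{(|0\rangle+|1\rangle)/\sqrt2,(|0\rangle-|1\rangle)/\sqrt2\}$, and $\mathscr{I}_R^y$ denotes it in the $y$-basis $\{(|0\rangle+i|1\rangle)/\sqrt2,(|0\rangle-i|1\rangle)/\sqrt2\}$. For a two-qubit state $\rho_{AB}$ on $\mathbb{C}^2\otimes\mathbb{C}^2$ (Alice's qubit first, Bob's second), $A\in\{x,y\}$ and $a=\pm$, let $\Pi_{\pm|A}=\frac12(\mathbb{1}_2\pm\sigma_A)$, $p(a|A)=\operatorname{Tr}[(\Pi_{a|A}\otimes\mathbb{1}_2)\rho_{AB}]$, and $\rho_{a|A}=\operatorname{Tr}_A[(\Pi_{a|A}\otimes\mathbb{1}_2)\rho_{AB}]/p(a|A)$. Define $$I_2(\rho_{AB})=\sum_{a=\pm}p(a|y)\,\mathscr{I}_R^x(\rho_{a|y})+\sum_{a=\pm}p(a|x)\,\mathscr{I}_R^y(\rho_{a|x}),$$ with terms having $p(a|A)=0$ taken to be $0$. Alice is said to steer the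 imaginarity of Bob's local state when $I_2(\rho_{AB})>\sqrt2$. *)

(* Defs.v *)
From HB Require Import structures.
From mathcomp Require Import all_boot all_order all_algebra.
From mathcomp Require Import sesquilinear spectral.
From mathcomp Require Import reals complex.
(* Not imported: its notation [_ ^t _] clashes with the one of sesquilinear. *)
From mathcomp Require mxtens.

Set Implicit Arguments.
Unset Strict Implicit.
Unset Printing Implicit Defensive.
Import Order.TTheory GRing.Theory Num.Theory.
Local Open Scope ring_scope.
Local Open Scope complex_scope.
Local Open Scope sesquilinear_scope.

Notation "A *t B" := (mxtens.tensmx A B)
  (at level 40, left associativity) : ring_scope.

Section TraceNorm.
Context {C : numClosedFieldType}.
Implicit Types n : nat.

(* [0 <= z] in [C] entails that [z] is real. *)
Definition psd n (A : 'M[C]_n) : Prop :=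
  A \is hermsymmx /\ forall v : 'cV[C]_n, 0 <= (v ^t* *m A *m v) 0 0.

Definition density n (rho : 'M[C]_n) : Prop := psd rho /\ \tr rho = 1.

(* The square root by functional calculus, for a normal matrix [A], which is
   P^-1 diag(d) P for P, d its spectral decomposition; [sqrtmx_psd] and
   [sqrtmxK] show that it is the positive square root when [A] is positive. *)
Definition sqrtmx n (A : 'M[C]_n) : 'M[C]_n :=
  invmx (spectralmx A) *m diag_mx (map_mx sqrtC (spectral_diag A))
    *m spectralmx A.

Definition trnorm n (V : 'M[C]_n) : C := \tr (sqrtmx (V ^t* *m V)).

Lemma adjmxM m n p (A : 'M[C]_(m, n)) (B : 'M[C]_(n, p)) :
  (A *m B) ^t* = B ^t* *m A ^t*.
Proof. by rewrite trmx_mul map_mxM. Qed.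

Lemma psd_adjmx_mul n (V : 'M[C]_n) : psd (V ^t* *m V).
Proof.
split=> [|v].
  by apply/is_hermitianmxP; rewrite expr0 scale1r adjmxM trmxCK.
rewrite mulmxA -adjmxM -mulmxA mxE sumr_ge0 // => i _.
by rewrite !mxE mulrC mul_conjC_ge0.
Qed.

Lemma psd_spectral n (A : 'M[C]_n) : psd A ->
  A = invmx (spectralmx A) *m diag_mx (spectral_diag A) *m spectralmx A.
Proof. by case=> /hermitian_normalmx /orthomx_spectralP. Qed.

Lemma psd_diag_ge0 n (A : 'M[C]_n) i : psd A -> 0 <= A i i.
Proof.
case=> _ /(_ (delta_mx i 0)).
by rewrite -mulmxA -colE trmx_delta map_delta_mx -rowE !mxE.
Qed.

Lemma psd_conj n (A P : 'M[C]_n) : psd A -> psd (P ^t* *m A *m P).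
Proof.
case=> /is_hermitianmxP; rewrite expr0 scale1r => Ah Apos; split=> [|v].
  by apply/is_hermitianmxP; rewrite expr0 scale1r !adjmxM trmxCK -Ah mulmxA.
by rewrite !mulmxA -adjmxM -!mulmxA mulmxA.
Qed.

Lemma psd_spectral_diag_ge0 n (A : 'M[C]_n) j :
  psd A -> 0 <= spectral_diag A 0 j.
Proof.
move=> Apsd; have AE := psd_spectral Apsd.
have PP := spectral_unit A.
have := psd_diag_ge0 j (psd_conj (invmx (spectralmx A)) Apsd).
rewrite invmx_unitary ?spectral_unitarymx // trmxCK.
rewrite -invmx_unitary ?spectral_unitarymx // {2}AE.
by rewrite mulmxA mulmxK // mulKVmx // mxE eqxx mulr1n.
Qed.

Lemma sqrtmx_psd n (A : 'M[C]_n) : psd A -> psd (sqrtmx A).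
Proof.
move=> Apsd; rewrite /sqrtmx invmx_unitary ?spectral_unitarymx //.
apply: psd_conj; split=> [|v].
  apply/is_hermitianmxP; rewrite expr0 scale1r tr_diag_mx map_diag_mx.
  congr diag_mx; apply/rowP=> j; rewrite !mxE.
  by rewrite [RHS]conj_Creal // ger0_real // sqrtC_ge0 psd_spectral_diag_ge0.
rewrite mul_mx_diag mxE sumr_ge0 // => j _; rewrite !mxE mulrAC mulr_ge0 //.
  by rewrite mulrC mul_conjC_ge0.
by rewrite sqrtC_ge0 psd_spectral_diag_ge0.
Qed.

Lemma sqrtmxK n (A : 'M[C]_n) : psd A -> sqrtmx A *m sqrtmx A = A.
Proof.
move=> Apsd; rewrite [RHS]psd_spectral // /sqrtmx.
rewrite !mulmxA mulmxK ?spectral_unit //; congr (_ *m _).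
rewrite -mulmxA mulmx_diag; congr (_ *m diag_mx _).
by apply/rowP=> j; rewrite !mxE -expr2 sqrtCK.
Qed.

End TraceNorm.

Section Imaginarity.
Context {R : realType}.
Local Notation C := R[i].

Definition sigma_x : 'M[C]_2 := \matrix_(i, j) (i != j)%:R.
Definition sigma_y : 'M[C]_2 :=
  \matrix_(i, j) if i == j then 0 else if i == 0 then - 'i else 'i.
Definition sigma_z : 'M[C]_2 :=
  \matrix_(i, j) if i == j then (-1) ^+ i else 0.

Definition sigma (k : 'I_3) : 'M[C]_2 :=
  nth 0 [:: sigma_x; sigma_y; sigma_z] k.

Definition ket (i : 'I_2) : 'cV[C]_2 := delta_mx i 0.

Definition xbasis (i : 'I_2) : 'cV[C]_2 :=
  ((Num.sqrt 2)^-1)%:C *: (ket 0 + (-1) ^+ i *: ket 1).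
Definition ybasis (i : 'I_2) : 'cV[C]_2 :=
  ((Num.sqrt 2)^-1)%:C *: (ket 0 + ((-1) ^+ i * 'i) *: ket 1).

Definition in_basis (e : 'I_2 -> 'cV[C]_2) (rho : 'M[C]_2) : 'M[C]_2 :=
  \matrix_(i, j) ((e i) ^t* *m rho *m e j) 0 0.

Definition robustness (e : 'I_2 -> 'cV[C]_2) (rho : 'M[C]_2) : C :=
  2^-1 * trnorm (in_basis e rho - (in_basis e rho)^T).

Definition ptraceA (M : 'M[C]_(2 * 2)) : 'M[C]_2 :=
  \matrix_(i, j)
    \sum_k M (mxtens.mxtens_index (k, i)) (mxtens.mxtens_index (k, j)).

(* The outcome [a = false] stands for +, [a = true] for -. *)
Definition meas (a : bool) (S : 'M[C]_2) : 'M[C]_2 :=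
  2^-1 *: (1%:M + (-1) ^+ a *: S).

Definition prob (rho : 'M[C]_(2 * 2)) (a : bool) (S : 'M[C]_2) : C :=
  \tr ((meas a S *t 1%:M) *m rho).

Definition cond_state (rho : 'M[C]_(2 * 2)) (a : bool) (S : 'M[C]_2) :
    'M[C]_2 :=
  (prob rho a S)^-1 *: ptraceA ((meas a S *t 1%:M) *m rho).

Definition avg_robustness (rho : 'M[C]_(2 * 2)) (S : 'M[C]_2)
    (e : 'I_2 -> 'cV[C]_2) : C :=
  \sum_(a : bool) if prob rho a S == 0 then 0
                  else prob rho a S * robustness e (cond_state rho a S).

Definition I2 (rho : 'M[C]_(2 * 2)) : C :=
  avg_robustness rho sigma_y xbasis + avg_robustness rho sigma_x ybasis.

(* [<] on [C] includes that both sides have the same imaginary part. *)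
Definition steers_imaginarity (rho : 'M[C]_(2 * 2)) : Prop :=
  (Num.sqrt 2)%:C < I2 rho.

Definition bloch2 (m n : 'rV[R]_3) (t : 'M[R]_3) : 'M[C]_(2 * 2) :=
  4^-1 *: (1%:M *t 1%:M
           + (\sum_i (m 0 i)%:C *: sigma i) *t 1%:M
           + 1%:M *t (\sum_i (n 0 i)%:C *: sigma i)
           + \sum_i \sum_j (t i j)%:C *: (sigma i *t sigma j)).

End Imaginarity.

(* Main.v *)
(* For an antisymmetric 2 x 2 matrix V, V^* V is the scalar |V 0 1|^2, so the
   robustness in a basis e is the modulus of the linear functional
   rho |-> rho_e 0 1 - rho_e 1 0.  On the Pauli matrices this functional is
   supported on sigma_y for the x-basis and on sigma_x for the y-basis, with a
   value of modulus 2 there, so each outcome contributes half of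
   |n_k +- t_kk|.  The convention for outcomes of probability zero is
   harmless because positivity of rho on product projectors gives
   |n_k +- t_kk| <= 1 +- m_k, the right-hand side being twice the
   probability. *)
Require Import Defs.
From mathcomp Require Import all_boot all_order all_algebra.
From mathcomp Require Import reals complex.
From mathcomp Require Import sesquilinear spectral ring lra.
From mathcomp Require mxtens.
Import Order.TTheory GRing.Theory Num.Theory.
Local Open Scope ring_scope.
Local Open Scope complex_scope.
Local Open Scope sesquilinear_scope.

(** * Positive matrices and the trace norm of antisymmetric matrices *)

Lemma sum_ord2 (V : nmodType) (F : 'I_2 -> V) : \sum_i F i = F 0 + F 1.
Proof. by rewrite !big_ord_recl big_ord0 addr0; congr (_ + F _); apply: val_inj. Qed.

Lemma ord2_cases (P : 'I_2 -> Prop) : P 0 -> P 1 -> forall i, P i.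
Proof.
move=> P0 P1 [[|[|//]] lti].
  by rewrite (_ : Ordinal lti = 0) //; apply: val_inj.
by rewrite (_ : Ordinal lti = 1) //; apply: val_inj.
Qed.

Lemma psd_tr_ge0 (C : numClosedFieldType) n (A : 'M[C]_n) :
  psd A -> 0 <= \tr A.
Proof. by move=> Apsd; rewrite sumr_ge0 // => i _; apply: psd_diag_ge0. Qed.

(** By cyclicity and idempotence the trace equals that of [P ^t* *m A *m P], which is again
    positive. *)
Lemma psd_tr_proj_ge0 (C : numClosedFieldType) n (A P : 'M[C]_n) :
  psd A -> P ^t* = P -> P *m P = P -> 0 <= \tr (P *m A).
Proof.
move=> Apsd Ph PP; have := psd_tr_ge0 _ _ _ (psd_conj P Apsd).
by rewrite Ph mxtrace_mulC mulmxA PP.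
Qed.

(** A scalar matrix commutes with the diagonalizing matrix, so the conjugation cancels. *)
Lemma spectral_diag_scalar (C : numClosedFieldType) n (c : C) :
  psd (c%:M : 'M[C]_n) -> spectral_diag (c%:M : 'M[C]_n) = const_mx c.
Proof.
move=> cpsd; have cE := psd_spectral cpsd; have PU := spectral_unit (c%:M : 'M[C]_n).
have : diag_mx (spectral_diag (c%:M : 'M[C]_n)) = diag_mx (const_mx c).
  rewrite diag_const_mx -[RHS](mulmxK PU) -scalar_mxC {3}cE.
  by rewrite !mulmxA mulmxV // mul1mx mulmxK.
by move/matrixP=> dE; apply/rowP=> i; have := dE i i; rewrite !mxE eqxx !mulr1n.
Qed.

Lemma tr_sqrtmx_scalar (C : numClosedFieldType) n (c : C) :
  psd (c%:M : 'M[C]_n) -> \tr (sqrtmx (c%:M : 'M[C]_n)) = sqrtC c *+ n.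
Proof.
move=> cpsd; rewrite /sqrtmx spectral_diag_scalar // map_const_mx.
by rewrite mxtrace_mulC mulmxA mulmxV ?spectral_unit // mul1mx diag_const_mx mxtrace_scalar.
Qed.

(** The square root of the scalar matrix [V ^t* *m V] is again scalar; the factor 2 is the trace of
    the identity. *)
Lemma trnorm_antisym2 (C : numClosedFieldType) (V : 'M[C]_2) :
  V^T = - V -> trnorm V = 2 * `|V 0 1|.
Proof.
move=> /matrixP Va.
have V10 : V 1 0 = - V 0 1 by have := Va 0 1; rewrite !mxE.
have Vii i : V i i = 0.
  have := Va i i; rewrite !mxE => /eqP; rewrite -subr_eq0 opprK -mulr2n.
  by rewrite mulrn_eq0 => /eqP.
have VV : V ^t* *m V = (`|V 0 1| ^+ 2)%:M.
  apply/matrixP; elim/ord2_cases; elim/ord2_cases;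
    rewrite !mxE sum_ord2 !mxE /= ?V10 ?Vii ?rmorph0 ?rmorphN;
    by rewrite ?mulr0 ?mul0r ?addr0 ?add0r ?mulrNN ?normCKC.
rewrite /trnorm VV tr_sqrtmx_scalar -?VV; last exact: psd_adjmx_mul.
by rewrite sqrCK ?normr_ge0 // mulr_natl.
Qed.

(** * Projectors built from Hermitian involutions *)

Lemma adj_half_add_sign (C : numClosedFieldType) n (S : 'M[C]_n) (a : bool) :
  S ^t* = S ->
  (2^-1 *: (1%:M + (-1) ^+ a *: S)) ^t* = 2^-1 *: (1%:M + (-1) ^+ a *: S).
Proof.
move=> /matrixP Sh; apply/matrixP=> i j; have := Sh i j; rewrite !mxE /= => Sij.
by rewrite rmorphM rmorphD fmorphV !rmorph_nat rmorphM rmorph_sign /= Sij eq_sym.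
Qed.

(** A signed involution [T] is still an involution, so [1 + T] squares to twice itself. *)
Lemma half_add_sign_idem (C : numClosedFieldType) n (S : 'M[C]_n) (a : bool) :
  S *m S = 1%:M ->
  let P := 2^-1 *: (1%:M + (-1) ^+ a *: S) in P *m P = P.
Proof.
move=> SS /=; set T := _ *: S.
have TT : T *m T = 1%:M.
  by rewrite -scalemxAl -scalemxAr scalerA SS -signr_addb addbb scale1r.
rewrite -scalemxAl -scalemxAr mulmxDl !mulmxDr TT !mulmx1 mul1mx.
rewrite [T + _]addrC -mulr2n -scaler_nat; congr (_ *: _).
by rewrite scalerA mulVf ?scale1r // pnatr_eq0.
Qed.

(** * Robustness as the modulus of a linear functional *)

Section Pauli.
Context {R : realType}.
Local Notation C := R[i].

(* Twice the imaginary part of the off-diagonal entry (times 'i) when M is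
   Hermitian, but linear in M for every M. *)
Definition imag_part (e : 'I_2 -> 'cV[C]_2) (M : 'M[C]_2) : C :=
  in_basis e M 0 1 - in_basis e M 1 0.

Lemma in_basisD e (M N : 'M[C]_2) :
  in_basis e (M + N) = in_basis e M + in_basis e N.
Proof.
apply/matrixP=> i j; rewrite [RHS]mxE ![in_basis _ _ _ _]mxE.
by rewrite mulmxDr mulmxDl [LHS]mxE.
Qed.

Lemma in_basisZ e c (M : 'M[C]_2) : in_basis e (c *: M) = c *: in_basis e M.
Proof.
apply/matrixP=> i j; rewrite [RHS]mxE ![in_basis _ _ _ _]mxE.
by rewrite -scalemxAr -scalemxAl [LHS]mxE.
Qed.

Lemma imag_partD e (M N : 'M[C]_2) :
  imag_part e (M + N) = imag_part e M + imag_part e N.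
Proof.
rewrite /imag_part in_basisD; set A := in_basis e M; set B := in_basis e N.
by rewrite [(A + B) 0 1]mxE [(A + B) 1 0]mxE opprD addrACA.
Qed.

Lemma imag_partZ e c (M : 'M[C]_2) :
  imag_part e (c *: M) = c * imag_part e M.
Proof.
rewrite /imag_part in_basisZ; set A := in_basis e M.
by rewrite [(c *: A) 0 1]mxE [(c *: A) 1 0]mxE mulrBr.
Qed.

Lemma imag_part_sum e (I : finType) (F : I -> 'M[C]_2) :
  imag_part e (\sum_i F i) = \sum_i imag_part e (F i).
Proof.
apply: (big_morph _ (imag_partD e)).
by rewrite -[X in imag_part e X](scale0r 0) imag_partZ mul0r.
Qed.

(** The factor 2 of the trace norm of an antisymmetric matrix cancels the one half in the
    robustness. *)
Lemma robustnessE e (M : 'M[C]_2) : robustness e M = `|imag_part e M|.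
Proof.
have subE (A : 'M[C]_2) : (A - A^T) 0 1 = A 0 1 - A 1 0 by rewrite !mxE.
rewrite /robustness trnorm_antisym2; last by rewrite linearB /= trmxK opprB.
by rewrite mulKf ?pnatr_eq0 // subE.
Qed.

(** * Partial trace over Alice's qubit *)

Lemma ptraceAD (M N : 'M[C]_(2 * 2)) :
  ptraceA (M + N) = ptraceA M + ptraceA N.
Proof.
by apply/matrixP=> i j; rewrite !mxE -big_split; apply: eq_bigr => k _; rewrite mxE.
Qed.

Lemma ptraceAZ c (M : 'M[C]_(2 * 2)) : ptraceA (c *: M) = c *: ptraceA M.
Proof.
by apply/matrixP=> i j; rewrite !mxE mulr_sumr; apply: eq_bigr => k _; rewrite mxE.
Qed.

Lemma ptraceA_sum (I : finType) (F : I -> 'M[C]_(2 * 2)) :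
  ptraceA (\sum_i F i) = \sum_i ptraceA (F i).
Proof.
apply: (big_morph _ ptraceAD).
by rewrite -[X in ptraceA X](scale0r 0) ptraceAZ scale0r.
Qed.

Lemma ptraceA_tens (A B : 'M[C]_2) : ptraceA (A *t B) = \tr A *: B.
Proof.
apply/matrixP=> i j; rewrite !mxE mulr_suml.
by apply: eq_bigr => k _; rewrite mxtens.tensmxE.
Qed.

Lemma mxtrace_ptraceA (M : 'M[C]_(2 * 2)) : \tr (ptraceA M) = \tr M.
Proof.
rewrite /mxtrace; under eq_bigr do rewrite mxE.
rewrite exchange_big pair_big /=.
rewrite [RHS](reindex (@mxtens.mxtens_index 2 2)) //=; last first.
  by exists (@mxtens.mxtens_unindex 2 2) => x _;
     rewrite (mxtens.mxtens_indexK, mxtens.mxtens_unindexK).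
by apply: eq_bigr => -[].
Qed.

(** * Pauli matrices and their spectral projectors *)

Lemma adj_sigma (k : 'I_3) : (sigma k : 'M[C]_2) ^t* = sigma k.
Proof.
case: k => [[|[|[|//]]] ltk]; apply/matrixP; elim/ord2_cases; elim/ord2_cases;
  rewrite !mxE /= ?rmorph0 ?rmorph1 ?rmorphN ?rmorph1 //=;
  by apply/eqP; rewrite eq_complex /= ?oppr0 ?opprK !eqxx.
Qed.

Lemma sigma_sqr (k : 'I_3) : (sigma k : 'M[C]_2) *m sigma k = 1%:M.
Proof.
case: k => [[|[|[|//]]] ltk]; apply/matrixP; elim/ord2_cases; elim/ord2_cases;
  rewrite !mxE sum_ord2 !mxE /=; apply/eqP; rewrite eq_complex /=;
  by apply/andP; split; apply/eqP; ring.
Qed.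

Lemma mxtrace_sigma (k : 'I_3) : \tr (sigma k : 'M[C]_2) = 0.
Proof.
by case: k => [[|[|[|//]]] ltk]; rewrite /mxtrace sum_ord2 !mxE /=; ring.
Qed.

Lemma mxtrace_sigmaM (k l : 'I_3) :
  \tr ((sigma k : 'M[C]_2) *m sigma l) = (k == l)%:R * 2.
Proof.
have [<-|] := eqVneq k l; first by rewrite sigma_sqr mxtrace_scalar mul1r.
case: k l => [[|[|[|//]]] ltk] [[|[|[|//]]] ltl] //= _;
  rewrite mul0r /mxtrace sum_ord2 !mxE !sum_ord2 !mxE /=;
  apply/eqP; rewrite eq_complex /=; apply/andP; split; apply/eqP; ring.
Qed.

Lemma mxtrace_meas a (k : 'I_3) : \tr (meas a (sigma k : 'M[C]_2)) = 1.
Proof.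
rewrite /meas mxtraceZ mxtraceD mxtrace_scalar mxtraceZ mxtrace_sigma mulr0.
by rewrite addr0 mulVf // pnatr_eq0.
Qed.

(** Trace orthogonality of the Pauli matrices: a measurement along axis [k] retains only [m 0 k] and
    row [k] of [t]. *)
Lemma mxtrace_measM a (k l : 'I_3) :
  \tr (meas a (sigma k : 'M[C]_2) *m sigma l) = (k == l)%:R * (-1) ^+ a.
Proof.
rewrite /meas -scalemxAl mulmxDl mul1mx -scalemxAl mxtraceZ mxtraceD mxtraceZ.
rewrite mxtrace_sigma mxtrace_sigmaM add0r.
by rewrite [_ * 2]mulrC [(-1) ^+ a * _]mulrCA mulKf ?pnatr_eq0 // mulrC.
Qed.

Lemma adj_meas a (k : 'I_3) :
  (meas a (sigma k : 'M[C]_2)) ^t* = meas a (sigma k).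
Proof. by rewrite /meas adj_half_add_sign // adj_sigma. Qed.

Lemma measK a (k : 'I_3) :
  meas a (sigma k : 'M[C]_2) *m meas a (sigma k) = meas a (sigma k).
Proof. by rewrite /meas half_add_sign_idem // sigma_sqr. Qed.

(** * Conditional states and outcome probabilities *)

(** Bob's conditional state before normalization: in each tensor term Alice's factor is replaced by
    its trace against the projector. *)
Lemma ptraceA_meas_bloch2 a (k : 'I_3) (m n : 'rV[R]_3) (t : 'M[R]_3) :
  ptraceA ((meas a (sigma k) *t 1%:M) *m bloch2 m n t) =
  4^-1 *: ((1 + (-1) ^+ a * (m 0 k)%:C) *: 1%:M
           + \sum_j ((n 0 j)%:C + (-1) ^+ a * (t k j)%:C) *: sigma j).
Proof.
rewrite /bloch2 -scalemxAr ptraceAZ !mulmxDr !mxtens.tensmx_mul.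
rewrite !ptraceAD !ptraceA_tens.
rewrite !mulmx1 !mul1mx mxtrace_meas !scale1r.
congr (_ *: _); rewrite scalerDl scale1r -!addrA; congr (_ + _).
congr (_ + _).
  rewrite mulmx_sumr linear_sum (bigD1 k) //= big1 => [|i ik].
    by rewrite addr0 -scalemxAr mxtraceZ mxtrace_measM eqxx mul1r mulrC.
  by rewrite -scalemxAr mxtraceZ mxtrace_measM eq_sym (negPf ik) mul0r mulr0.
rewrite [RHS](eq_bigr (fun j => (n 0 j)%:C *: sigma j
          + ((-1) ^+ a * (t k j)%:C) *: sigma j)) => [|j _]; last first.
  by rewrite scalerDl.
rewrite big_split /=; congr (_ + _); rewrite mulmx_sumr ptraceA_sum.
rewrite (bigD1 k) //= [X in _ + X]big1 ?addr0 => [|i ik].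
  rewrite mulmx_sumr ptraceA_sum; apply: eq_bigr => j _.
  rewrite -scalemxAr ptraceAZ mxtens.tensmx_mul ptraceA_tens mul1mx mxtrace_measM.
  by rewrite eqxx mul1r scalerA mulrC.
rewrite mulmx_sumr ptraceA_sum big1 // => j _.
rewrite -scalemxAr ptraceAZ mxtens.tensmx_mul ptraceA_tens mul1mx mxtrace_measM.
by rewrite eq_sym (negPf ik) mul0r scale0r scaler0.
Qed.

(** An operator on Bob's qubit alone is block diagonal in Alice's index, so it passes through the
    sum over that index. *)
Lemma ptraceA_mulr (B : 'M[C]_2) (M : 'M[C]_(2 * 2)) :
  ptraceA ((1%:M *t B) *m M) = B *m ptraceA M.
Proof.
apply/matrixP=> i j; rewrite !mxE.
under [RHS]eq_bigr do rewrite mxE mulr_sumr.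
rewrite [RHS]exchange_big /=; apply: eq_bigr => k _; rewrite mxE.
rewrite (reindex (@mxtens.mxtens_index 2 2)) /=; last first.
  by exists (@mxtens.mxtens_unindex 2 2) => x _;
     rewrite (mxtens.mxtens_indexK, mxtens.mxtens_unindexK).
transitivity (\sum_k' \sum_i' (1%:M *t B) (mxtens.mxtens_index (k, i))
    (mxtens.mxtens_index (k', i'))
  * M (mxtens.mxtens_index (k', i')) (mxtens.mxtens_index (k, j))).
  by rewrite pair_big /=; apply: eq_bigr => -[].
rewrite (bigD1 k) //= [X in _ + X]big1 ?addr0 => [|k' k'k].
  by apply: eq_bigr => i' _; rewrite mxtens.tensmxE mxE eqxx mul1r.
rewrite big1 // => i' _; rewrite mxtens.tensmxE mxE eq_sym (negPf k'k).
by rewrite !mul0r.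
Qed.

Lemma prob_bloch2 a (k : 'I_3) (m n : 'rV[R]_3) (t : 'M[R]_3) :
  prob (bloch2 m n t) a (sigma k) = (2^-1 * (1 + (-1) ^+ a * m 0 k))%:C.
Proof.
rewrite /prob -mxtrace_ptraceA ptraceA_meas_bloch2 mxtraceZ mxtraceD mxtraceZ.
rewrite mxtrace_scalar linear_sum big1 => [|j _]; last first.
  by rewrite /= mxtraceZ mxtrace_sigma mulr0.
rewrite addr0 rmorphM fmorphV rmorph_nat rmorphD rmorph1 rmorphM rmorph_sign.
by field.
Qed.

(** Bob is also projected along axis [k]. His two outcomes give both signs of the quantity inside
    the modulus. *)
Lemma density_bloch2_bound (a : bool) (k : 'I_3) (m n : 'rV[R]_3) (t : 'M[R]_3) :
  density (bloch2 m n t) ->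
  `|n 0 k + (-1) ^+ a * t k k| <= 1 + (-1) ^+ a * m 0 k.
Proof.
case=> rho_psd _.
have pos (b : bool) : 0 <= 1 + (-1) ^+ a * m 0 k + (-1) ^+ b * (n 0 k + (-1) ^+ a * t k k).
  have : 0 <= \tr ((meas a (sigma k) *t meas b (sigma k)) *m bloch2 m n t).
    apply: psd_tr_proj_ge0 => //; last by rewrite mxtens.tensmx_mul !measK.
    by rewrite mxtens.trmx_tens mxtens.map_mxT !adj_meas.
  (* Bob's projector is split off so that the conditional state computed above can be reused. *)
  have -> : meas a (sigma k) *t meas b (sigma k)
      = (1%:M *t meas b (sigma k)) *m (meas a (sigma k) *t 1%:M) :> 'M[C]_(2 * 2).
    by rewrite mxtens.tensmx_mul mulmx1 mul1mx.
  rewrite -mulmxA -mxtrace_ptraceA.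
  rewrite ptraceA_mulr ptraceA_meas_bloch2 -scalemxAr mxtraceZ mulmxDr mxtraceD -scalemxAr.
  rewrite mulmx1 mxtraceZ mxtrace_meas mulmx_sumr linear_sum (bigD1 k) //= big1.
    rewrite -scalemxAr mxtraceZ mxtrace_measM eqxx mul1r addr0 mulr1.
    rewrite pmulr_rge0 ?invr_gt0 ?ltr0n //.
    rewrite -ler0c !(rmorphD, rmorphM, rmorph_sign, rmorph1) /=.
    by rewrite [(-1) ^+ b * _]mulrC.
  move=> i ik; rewrite -scalemxAr mxtraceZ mxtrace_measM.
  by rewrite eq_sym (negPf ik) mul0r mulr0.
rewrite ler_norml; have := pos false; have := pos true.
by rewrite expr0 expr1 mul1r mulN1r => *; apply/andP; split; lra.
Qed.

(** * Average robustness for one measurement *)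

Lemma normc_real (x : R) : `|x%:C| = `|x|%:C.
Proof. by rewrite normc_def /= expr0n addr0 sqrtr_sqr. Qed.

(** The hypotheses on [imag_part] leave only the coefficient of [sigma k]; the prefactor 1/4 times
    [|z| = 2] gives the one half. *)
Lemma avg_robustness_bloch2 (k : 'I_3) e z (m n : 'rV[R]_3) (t : 'M[R]_3) :
  density (bloch2 m n t) ->
  imag_part e 1%:M = 0 ->
  (forall j, imag_part e (sigma j) = (j == k)%:R * z) -> `|z| = 2 ->
  avg_robustness (bloch2 m n t) (sigma k) e =
  (2^-1 * (`|n 0 k - t k k| + `|n 0 k + t k k|))%:C.
Proof.
move=> rho_density e1 eS z2.
have term a : (if prob (bloch2 m n t) a (sigma k) == 0 then 0
    else prob (bloch2 m n t) a (sigma k)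
         * robustness e (cond_state (bloch2 m n t) a (sigma k)))
    = (2^-1 * `|n 0 k + (-1) ^+ a * t k k|)%:C.
  have bound := density_bloch2_bound a k m n t rho_density.
  have p_ge0 : 0 <= prob (bloch2 m n t) a (sigma k).
    by rewrite prob_bloch2 ler0c mulr_ge0 ?invr_ge0 ?ler0n // (le_trans _ bound).
  case: eqVneq => [|p_neq0].
    (* At probability zero the bound forces the modulus to vanish, in agreement with the default
       value 0. *)
    rewrite prob_bloch2 => /complexI /eqP; rewrite mulf_eq0 invr_eq0 pnatr_eq0 /=.
    move=> /eqP m0; move: bound; rewrite m0 normr_le0 => /eqP ->.
    by rewrite normr0 mulr0.
  (* The probability is its own modulus, so it cancels the normalization of the conditional
     state. *)
  rewrite robustnessE /cond_state imag_partZ normrM normfV (ger0_norm p_ge0).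
  rewrite mulVKf // ptraceA_meas_bloch2 imag_partZ imag_partD imag_partZ e1.
  rewrite mulr0 add0r imag_part_sum (bigD1 k) //= big1 => [|j jk]; last first.
    by rewrite imag_partZ eS (negPf jk) mul0r mulr0.
  rewrite addr0 imag_partZ eS eqxx mul1r !normrM z2.
  rewrite -(rmorph_sign (real_complex R)) -rmorphM -rmorphD normc_real /=.
  rewrite normfV normr_nat rmorphM fmorphV rmorph_nat /=.
  by field.
rewrite /avg_robustness (eq_bigr _ (fun a _ => term a)) big_bool.
rewrite expr0 expr1 mul1r mulN1r.
by rewrite mulrDr rmorphD.
Qed.

(** * The functional in the x- and y-bases *)

Lemma in_basisE e (M : 'M[C]_2) i j : in_basis e M i j =
  \sum_k \sum_l ((e i k 0)^*)%R * M k l * e j l 0.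
Proof.
rewrite !mxE; under eq_bigr do rewrite mxE mulr_suml.
by rewrite exchange_big /=; do 2![apply: eq_bigr => ? _]; rewrite !mxE.
Qed.

(** Both bases consist of vectors [(a, b)] and [(a, -b)]. Exchanging them flips the sign of [b], so
    the diagonal entries of [M] cancel and the others double. *)
Lemma imag_part_antipodal (e : 'I_2 -> 'cV[C]_2) (M : 'M[C]_2) (a b : C) :
  (forall i, e i 0 0 = a) -> e 0 1 0 = b -> e 1 1 0 = - b ->
  imag_part e M = 2 * ((b^*)%R * M 1 0 * a - (a^*)%R * M 0 1 * b).
Proof.
move=> e0 e01 e11.
rewrite /imag_part !in_basisE !sum_ord2 !e0 e01 e11 (rmorphN Num.conj b) /=.
(* The conjugates are generalized to independent variables: the identity is purely polynomial. *)
by move: (a^*)%R (b^*)%R => a' b'; ring.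
Qed.

Local Notation c := (((Num.sqrt 2)^-1)%:C : C).

Lemma sqr_inv_sqrt2 : c * c = 2^-1.
Proof.
by rewrite -rmorphM -invfM -expr2 sqr_sqrtr ?ler0n // fmorphV rmorph_nat.
Qed.

Lemma conj_inv_sqrt2 : (c^*)%R = c.
Proof. by apply/eqP; rewrite eq_complex /= oppr0 !eqxx. Qed.

Lemma conj_inv_sqrt2_i : ((c * 'i)^*)%R = - (c * 'i).
Proof.
have conj_i : (('i : C)^*)%R = - 'i.
  by apply/eqP; rewrite eq_complex /= oppr0 !eqxx.
by rewrite (rmorphM Num.conj c 'i) /= conj_inv_sqrt2 conj_i mulrN.
Qed.

Lemma imag_part_xbasis (M : 'M[C]_2) : imag_part xbasis M = M 1 0 - M 0 1.
Proof.
have x0 i : xbasis i 0 0 = c by rewrite !mxE /= !(mulr0, mulr1, addr0).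
have x01 : xbasis 0 1 0 = c by rewrite !mxE /= !(expr0, mulr1, add0r).
have x11 : xbasis 1 1 0 = - c by rewrite !mxE /= !(expr1, mulr1, add0r, mulrN).
rewrite (imag_part_antipodal _ _ _ _ x0 x01 x11).
rewrite conj_inv_sqrt2 ![c * _ * c]mulrAC sqr_inv_sqrt2 -mulrBr.
by rewrite mulVKf // pnatr_eq0.
Qed.

Lemma imag_part_ybasis (M : 'M[C]_2) :
  imag_part ybasis M = - 'i * (M 0 1 + M 1 0).
Proof.
have y0 i : ybasis i 0 0 = c by rewrite !mxE /= !(mulr0, mulr1, addr0).
have y01 : ybasis 0 1 0 = c * 'i.
  by rewrite !mxE /= !(expr0, mulr1, mul1r, add0r).
have y11 : ybasis 1 1 0 = - (c * 'i).
  by rewrite !mxE /= !(expr1, mulN1r, mulr1, add0r, mulrN).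
rewrite (imag_part_antipodal _ _ _ _ y0 y01 y11).
rewrite conj_inv_sqrt2 conj_inv_sqrt2_i.
(* With [x = c] and [y = 'i], this isolates [c * c = 2^-1], which absorbs the factor 2. *)
have factor (x y p q : C) :
    2 * (- (x * y) * p * x - x * q * (x * y)) = 2 * (x * x) * (- y * (q + p)).
  by ring.
by rewrite factor sqr_inv_sqrt2 divff ?mul1r // pnatr_eq0.
Qed.

(** The x-functional sees only the antisymmetric part of a matrix, and [sigma_y] is the only Pauli
    matrix that is not symmetric. *)
Lemma imag_part_xbasis_sigma (j : 'I_3) :
  imag_part xbasis (sigma j : 'M[C]_2) = (j == 1)%:R * (2 * 'i).
Proof.
rewrite imag_part_xbasis; case: j => [[|[|[|//]]] ltj];
  rewrite !mxE /= ?subrr ?mul0r ?mul1r //.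
by rewrite opprK mulr_natl mulr2n.
Qed.

(** The y-functional sums the off-diagonal entries: they cancel in [sigma_y], vanish in [sigma_z]
    and add up to 2 in [sigma_x]. *)
Lemma imag_part_ybasis_sigma (j : 'I_3) :
  imag_part ybasis (sigma j : 'M[C]_2) = (j == 0)%:R * (2 * - 'i).
Proof.
rewrite imag_part_ybasis; case: j => [[|[|[|//]]] ltj];
  rewrite !mxE /= ?addNr ?addr0 ?mul0r ?mulr0 ?mul1r //.
by rewrite mulrC.
Qed.

Lemma norm_i : `|'i : C| = 1.
Proof. by rewrite normc_def /= expr0n expr1n add0r sqrtr1. Qed.
End Pauli.

(* The indices 1, 2, 3 of the coordinates are 0, 1, 2 in 'I_3. *)
Theorem theorem2 (R : realType) (rho : 'M[R[i]]_(2 * 2))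
    (m n : 'rV[R]_3) (t : 'M[R]_3)
    (rho_density : density rho) (rhoE : rho = bloch2 m n t) :
  I2 rho = (2^-1 * (`|n 0 0 - t 0 0| + `|n 0 0 + t 0 0|
                    + `|n 0 1 - t 1 1| + `|n 0 1 + t 1 1|))%:C
  /\ (Num.sqrt 2 < 2^-1 * (`|n 0 0 - t 0 0| + `|n 0 0 + t 0 0|
                    + `|n 0 1 - t 1 1| + `|n 0 1 + t 1 1|)
      -> steers_imaginarity rho).
Proof.
subst rho.
suff I2E : I2 (bloch2 m n t) = (2^-1 * (`|n 0 0 - t 0 0| + `|n 0 0 + t 0 0|
                    + `|n 0 1 - t 1 1| + `|n 0 1 + t 1 1|))%:C.
  by split=> //; rewrite /steers_imaginarity I2E ltcR.
(* [sigma_y] and [sigma_x] are [sigma 1] and [sigma 0] by computation; each is paired with the basis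
   whose functional detects it. *)
rewrite /I2 (avg_robustness_bloch2 1 xbasis (2 * 'i)) //.
- rewrite (avg_robustness_bloch2 0 ybasis (2 * - 'i)) //.
  + by rewrite -rmorphD -mulrDr addrC !addrA.
  + by rewrite imag_part_ybasis !mxE addr0 mulr0.
  + exact: imag_part_ybasis_sigma.
  + by rewrite normrM normrN norm_i normr_nat mulr1.
- by rewrite imag_part_xbasis !mxE subrr.
- exact: imag_part_xbasis_sigma.
- by rewrite normrM norm_i normr_nat mulr1.
Qed.
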